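(* Let $P(L)$, $P_2(L)$ and $P_4(L)$ be the numbers of polygons in the $L\times L$ square with, respectively, no further restriction; at least one edge in each of the top and bottom sides of the square; and at least one edge in each of the four sides of the square. Then $$\lim_{L\to\infty}\frac{1}{L^2}\log P_4(L)=\lim_{L\to\infty}\frac{1}{L^2}\log P_2(L)=\lim_{L\to\infty}\frac{1}{L^2}\log P(L)=\log\lambda ,$$ where $\log\lambda=\lim_{L\to\infty}\frac{1}{L^2}\log C(L)$ and $C(L)$ is the number of self-avoiding walks crossing the $L\times L$ square from one corner vertex to the opposite corner vertex.
   Context: For a positive integer $L$, the $L\times L$ square is the subgraph of the square lattice $\mathbb{Z}^2$ (nearest-neighbour edges) induced by the vertex set $\{0,1,\dots,L\}^2$. Its bottom, top, left and right sides are the sets of edges of the square lying in the lines $y=0$, $y=L$, $x=0$, $x=L$ respectively. A self-avoiding walk is a nearest-neighbour lattice path that visits no vertex more than once. $C(L)$ is the number of self-avoiding walks that stay in the $L\times L$ square, start at a fixed corner vertex (say $(0,0)$) and end at the opposite corner vertex (say $(L,L)$). It is known from earlier work that $\lim_{L\to\infty} L^{-2}\log C(L)$ exists and is finite; $\lambda$ is defined by setting this limit equal to $\log\lambda$. A polygon is a simple closed cycle, regarded as an (unrooted, unoriented) subgraph of the lattice; polygons in the square are counted as distinct subgraphs of the fixed square (translates are counted as different). *)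

(* Defs.v *)
From mathcomp Require Import all_boot all_order all_algebra.
From mathcomp Require Import all_classical all_reals all_analysis.

Set Implicit Arguments.
Unset Strict Implicit.
Unset Printing Implicit Defensive.

Import Order.TTheory GRing.Theory Num.Theory.
Import numFieldNormedType.Exports.

Local Open Scope nat_scope.

(* The vertex (x, y) of {0, ..., L}^2, with x the abscissa. *)
Definition vertex (L : nat) : finType := ('I_L.+1 * 'I_L.+1)%type.

(* Nearest neighbours are the lattice points at l1-distance 1;
   `|m - n| is the distance between naturals, not truncated subtraction. *)
Definition adj (L : nat) : rel (vertex L) :=
  fun u v => `|u.1 - v.1| + `|u.2 - v.2| == 1.

Definition edges (L : nat) : {set {set vertex L}} :=
  [set [set p.1; p.2] | p : vertex L * vertex L & adj p.1 p.2].

Definition bottom_side (L : nat) : {set {set vertex L}} :=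
  [set e in edges L | [forall v in e, val v.2 == 0]].
Definition top_side (L : nat) : {set {set vertex L}} :=
  [set e in edges L | [forall v in e, val v.2 == L]].
Definition left_side (L : nat) : {set {set vertex L}} :=
  [set e in edges L | [forall v in e, val v.1 == 0]].
Definition right_side (L : nat) : {set {set vertex L}} :=
  [set e in edges L | [forall v in e, val v.1 == L]].

(* A walk is the sequence of the vertices it visits.  As these are distinct,
   the bound #|vertex L| on its length excludes no self-avoiding walk; it only
   makes the type of candidates finite. *)
Definition crossing_walks (L : nat) : {set {bseq #|vertex L| of vertex L}} :=
  [set w : {bseq #|vertex L| of vertex L} |
    [&& ohead w == Some (ord0, ord0), last (ord0, ord0) w == (ord_max, ord_max),
        sorted (@adj L) w & uniq w]].

Definition C (L : nat) : nat := #|crossing_walks L|.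

(* [next c v] is the cyclic successor of v in c, so that this is the set of
   edges traversed by the closed walk c. *)
Definition cycle_edges (L : nat) (c : seq (vertex L)) : {set {set vertex L}} :=
  [set [set v; next c v] | v in c].

(* A polygon is identified with its set of edges, which forgets the root and the
   orientation of the cyclic sequence c.  The condition 2 < size c excludes the
   degenerate closed walk that goes back and forth along a single edge. *)
Definition polygons (L : nat) : {set {set {set vertex L}}} :=
  [set cycle_edges c | c : {bseq #|vertex L| of vertex L} &
    (2 < size c) && ucycleb (@adj L) c].

Definition P (L : nat) : nat := #|polygons L|.

Definition P2 (L : nat) : nat :=
  #|[set E in polygons L | (E :&: bottom_side L != finset.set0) &&
                           (E :&: top_side L != finset.set0)]|.

Definition P4 (L : nat) : nat :=
  #|[set E in polygons L | [&& E :&: bottom_side L != finset.set0,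
                               E :&: top_side L != finset.set0,
                               E :&: left_side L != finset.set0 &
                               E :&: right_side L != finset.set0]]|.

Local Open Scope ring_scope.
Local Open Scope classical_set_scope.

(* The sequence L^-2 log N(L); its term at L = 0 is a junk value. *)
Definition growth (R : realType) (N : nat -> nat) : R^nat :=
  fun L => ln ((N L)%:R : R) / L%:R ^+ 2.

Definition lambda (R : realType) : R := expR (lim (growth R C @ \oo)).

(* Main.v *)
Require Import Defs.
From mathcomp Require Import all_boot all_order all_algebra.
From mathcomp Require Import all_classical all_reals all_analysis.
From mathcomp Require Import zify ring lra.
Import Order.TTheory GRing.Theory Num.Theory.
Import numFieldNormedType.Exports.

(* Tiling a large square by k x k copies (k odd) of the L x L square, at distance
   L + 1 from each other, and running through them along a snake, with the walk in
   every other cell reflected, gives C(k(L+1)-1) >= C(L)^(k^2).  As C is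
   nondecreasing and C(L) <= 5^((L+1)^2), log C(L) / (L+1)^2 converges to its
   supremum.  A crossing walk closes up around the square into a polygon that meets
   the four sides of a square of size L + 2, so C(L) <= P4(L+2).  Conversely, removing
   the edge to the right of the lowest leftmost vertex v of a polygon and joining its
   ends to two opposite corners of a square of size L + 2 gives a crossing walk that,
   together with v, determines the polygon, so P(L) <= (L+1)^2 C(L+2). *)

Set Implicit Arguments.
Unset Strict Implicit.
Unset Printing Implicit Defensive.

Local Open Scope nat_scope.

(** * Self-avoiding walks between opposite corners of a rectangle *)

(** Natural coordinates let walks be shifted between boxes of different sizes without casts between
    ordinal types. *)
Definition site : Type := (nat * nat)%type.

Definition nadj : rel site := fun u v => `|u.1 - v.1| + `|u.2 - v.2| == 1.

Definition saw (p q : site) (s : seq site) : bool :=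
  [&& ohead s == Some p, last p s == q, sorted nadj s & uniq s].

Definition in_box (a b : nat) : pred site := fun p => (p.1 <= a) && (p.2 <= b).

Lemma saw1 p : saw p p [:: p].
Proof. by rewrite /saw /= !eqxx. Qed.

Lemma saw_cat p q p' q' s s' :
  saw p q s -> saw p' q' s' -> nadj q p' ->
  (forall z : site, z \in s -> z \in s' -> False) -> saw p q' (s ++ s').
Proof.
case: s => [|x s] /and4P[/eqP//= [->{x}] /eqP <-{q} Ps Us].
case: s' => [|x' s'] /and4P[/eqP//= [->{x'}] /eqP <-{q'} Ps' Us'] qp' dis.
apply/and4P; split; rewrite ?eqxx //.
- by rewrite /= last_cat.
- by rewrite /= cat_path Ps /= qp'.
- rewrite -cat_cons cat_uniq; apply/and3P; split=> //; apply/hasPn => z zs'.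
  by apply/negP => zs; apply: (dis z).
Qed.

Lemma saw_map (f : site -> site) p q s :
  {in s &, injective f} -> {in s &, {homo f : u v / nadj u v}} ->
  saw p q s -> saw (f p) (f q) (map f s).
Proof.
move=> injf adjf /and4P[]; case: s injf adjf => //= x s injf adjf.
move=> /eqP[<-{p}] /eqP <-{q} Ps Us; apply/and4P; split; rewrite ?eqxx //.
- by rewrite /= last_map.
- apply: (@homo_sorted_in _ _ (mem (x :: s)) f nadj nadj (x :: s)) => //.
  by apply/allP.
- by move: Us; rewrite -[_ && _]/(uniq (x :: s)) -(map_inj_in_uniq injf).
Qed.

(** * Straight segments *)

Definition seg (m n : nat) : seq nat :=
  if m <= n then iota m (n - m).+1 else rev (iota n (m - n).+1).

Lemma mem_seg m n i : (i \in seg m n) = (minn m n <= i <= maxn m n).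
Proof. by rewrite /seg; case: leqP => mn; rewrite ?mem_rev mem_iota; lia. Qed.

Lemma seg_uniq m n : uniq (seg m n).
Proof. by rewrite /seg; case: leqP => mn; rewrite ?rev_uniq iota_uniq. Qed.

Lemma seg_head m n : ohead (seg m n) = Some m.
Proof.
rewrite /seg; case: leqP => mn //.
by rewrite -addn1 iotaD rev_cat /=; congr Some; lia.
Qed.

Lemma seg_last k m n : last k (seg m n) = n.
Proof.
rewrite /seg; case: leqP => mn; last by rewrite /= rev_cons last_rcons.
by rewrite -addn1 iotaD last_cat /=; lia.
Qed.

Lemma seg_sorted m n : sorted (fun i j : nat => `|i - j| == 1) (seg m n).
Proof.
have H k l : sorted (fun i j : nat => `|i - j| == 1) (iota k l).
  case: l => //= l; elim: l k => //= l IHl k; rewrite IHl andbT; lia.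
rewrite /seg; case: leqP => mn //; rewrite rev_sorted.
by under eq_sorted do rewrite distnC.
Qed.

Definition hseg (y x x' : nat) : seq site := [seq (z, y) | z <- seg x x'].
Definition vseg (x y y' : nat) : seq site := [seq (x, z) | z <- seg y y'].

Lemma mem_hseg y x x' (p : site) :
  (p \in hseg y x x') = (p.2 == y) && (minn x x' <= p.1 <= maxn x x').
Proof.
case: p => a b; rewrite -mem_seg /=; apply/mapP/andP => [[z zs [-> ->]]//|].
by case=> /eqP-> za; exists a.
Qed.

Lemma mem_vseg x y y' (p : site) :
  (p \in vseg x y y') = (p.1 == x) && (minn y y' <= p.2 <= maxn y y').
Proof.
case: p => a b; rewrite -mem_seg /=; apply/mapP/andP => [[z zs [-> ->]]//|].
by case=> /eqP-> zb; exists b.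
Qed.

Lemma saw_hseg y x x' : saw (x, y) (x', y) (hseg y x x').
Proof.
rewrite /saw /hseg last_map seg_last map_inj_uniq ?seg_uniq; last by move=> ? ? [].
rewrite eqxx andbT /=; have := seg_head x x'; have := seg_sorted x x'.
case: (seg x x') => //= z s zs [zE]; move: zs; rewrite zE; rewrite eqxx path_map /=.
by apply: sub_path => i j; rewrite /nadj /=; lia.
Qed.

Lemma saw_vseg x y y' : saw (x, y) (x, y') (vseg x y y').
Proof.
rewrite /saw /vseg last_map seg_last map_inj_uniq ?seg_uniq; last by move=> ? ? [].
rewrite eqxx andbT /=; have := seg_head y y'; have := seg_sorted y y'.
case: (seg y y') => //= z s zs [zE]; move: zs; rewrite zE; rewrite eqxx path_map /=.
by apply: sub_path => i j; rewrite /nadj /=; lia.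
Qed.

(** * Enumerating the walks in a box *)

Definition pcoord (a b : nat) (p : 'I_a.+1 * 'I_b.+1) : site := (val p.1, val p.2).

Lemma pcoord_inj a b : injective (@pcoord a b).
Proof. by move=> [? ?] [? ?] [] /val_inj -> /val_inj ->. Qed.

Lemma pcoord_in_box a b (p : 'I_a.+1 * 'I_b.+1) : in_box a b (pcoord p).
Proof. by rewrite /in_box /= -ltnS ltn_ord -ltnS ltn_ord. Qed.

(** [inord] sends out-of-range coordinates to 0, so this inverts [pcoord] only on the box. *)
Definition unpcoord (a b : nat) (p : site) : 'I_a.+1 * 'I_b.+1 :=
  (inord p.1, inord p.2).

Lemma unpcoordK a b : {in in_box a b, cancel (unpcoord a b) (@pcoord a b)}.
Proof. by move=> [x y] /andP[/= xa yb]; rewrite /pcoord /= !inordK. Qed.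

(* The bound on the length is automatic; it makes the enumeration finite. *)
Definition walks (a b : nat) : seq (seq site) :=
  [seq map (@pcoord a b) (val w) |
    w : {bseq #|{: 'I_a.+1 * 'I_b.+1}| of 'I_a.+1 * 'I_b.+1} in
    [pred w | saw (0, 0) (a, b) (map (@pcoord a b) (val w))]].

Lemma walks_uniq a b : uniq (walks a b).
Proof.
rewrite map_inj_uniq ?enum_uniq // => w w' /inj_map ww'; apply: val_inj.
exact/ww'/pcoord_inj.
Qed.

Lemma mem_walks a b s :
  (s \in walks a b) = saw (0, 0) (a, b) s && all (in_box a b) s.
Proof.
rewrite /walks; apply/mapP/andP => [[w + ->]|[sS /allP sB]].
  rewrite mem_enum inE => Pw; split=> //; apply/allP => _ /mapP[p _ ->].
  exact: pcoord_in_box.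
have gK : map (@pcoord a b) (map (unpcoord a b) s) = s.
  by rewrite -map_comp map_id_in // => p /sB /unpcoordK.
have Us : uniq (map (unpcoord a b) s).
  by move: sS => /and4P[_ _ _]; rewrite -{1}gK => /map_uniq.
have sz : size (map (unpcoord a b) s) <= #|{: 'I_a.+1 * 'I_b.+1}|.
  by rewrite -(card_uniqP Us) max_card.
by exists (Bseq sz); rewrite ?mem_enum ?inE /= gK.
Qed.

Lemma walks_cons a b s : s \in walks a b -> s = (0, 0) :: behead s.
Proof.
rewrite mem_walks => /andP[/and4P[/eqP + _ _ _] _].
by case: s => //= p s [->].
Qed.

(** Rectangles are needed because the gluing proceeds one direction at a time. *)
Definition W (a b : nat) : nat := size (walks a b).

Lemma C_W L : C L = W L L.
Proof.
rewrite /W size_map -cardE; apply: eq_card => w; rewrite !inE /saw.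
rewrite map_inj_uniq; last exact: pcoord_inj.
rewrite sorted_map (_ : (0, 0) = @pcoord L L (ord0, ord0)) // last_map.
rewrite (_ : (L, L) = @pcoord L L (ord_max, ord_max)) //.
rewrite (inj_eq (@pcoord_inj L L)); congr andb.
by case: w => -[|x s] ?.
Qed.

Lemma leq_size_inj (T1 T2 : eqType) (f : T1 -> T2) (s1 : seq T1) (s2 : seq T2) :
  uniq s1 -> {in s1 &, injective f} -> {in s1, forall x, f x \in s2} ->
  size s1 <= size s2.
Proof.
move=> U1 injf fs; rewrite -(size_map f); apply: uniq_leq_size.
  by rewrite map_inj_in_uniq.
by move=> _ /mapP[x xs ->]; apply: fs.
Qed.

Lemma W_transpose a b : W a b = W b a.
Proof.
have le c d : W c d <= W d c.
  apply: (leq_size_inj (f := map (fun p : site => (p.2, p.1)))) => [||s].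
  - exact: walks_uniq.
  - by move=> s t _ _; apply: inj_map => -[? ?] [? ?] [-> ->].
  rewrite !mem_walks => /andP[sS /allP sB]; apply/andP; split.
    apply: (saw_map (p := (0, 0)) (q := (c, d))) sS => -[? ?] [? ?] _ _ /=.
      by case=> -> ->.
    by rewrite /nadj /= addnC.
  by apply/allP => _ /mapP[p /sB + ->]; rewrite /in_box /= andbC.
by apply/eqP; rewrite eqn_leq !le.
Qed.

Lemma W_leqSl a b : W a b <= W a.+1 b.
Proof.
apply: (leq_size_inj (f := fun s => rcons s (a.+1, b))) => [||s].
- exact: walks_uniq.
- by move=> s t _ _ /rcons_inj[].
rewrite !mem_walks => /andP[sS /allP sB]; apply/andP; split.
  rewrite -cats1; apply: (saw_cat (q := (a, b)) (p' := (a.+1, b))) => //.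
  - exact: saw1.
  - by rewrite /nadj /=; lia.
  - by move=> z /sB zB; rewrite inE => /eqP zE; move: zB; rewrite zE /in_box /=; lia.
apply/allP => z; rewrite mem_rcons inE => /orP[/eqP ->|/sB].
  by rewrite /in_box /=; lia.
by rewrite /in_box; lia.
Qed.

Lemma W_leqSr a b : W a b <= W a b.+1.
Proof. by rewrite W_transpose [W a _]W_transpose W_leqSl. Qed.

Lemma C_mono : {homo C : m n / m <= n}.
Proof.
apply: homo_leq leq_trans _ => // n; rewrite !C_W.
exact: leq_trans (W_leqSl _ _) (W_leqSr _ _).
Qed.

Lemma C_gt0 L : 0 < C L.
Proof.
apply: leq_trans (C_mono (leq0n L)); rewrite C_W /W -has_predT; apply/hasP.
by exists [:: (0, 0)] => //; rewrite mem_walks.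
Qed.

(** * Gluing walks in adjacent boxes *)

Lemma cat_inj_pred (T : eqType) (A : pred T) (s t s' t' : seq T) :
  all A s -> all (predC A) t -> all A s' -> all (predC A) t' ->
  s ++ t = s' ++ t' -> s = s' /\ t = t'.
Proof.
have F (B : pred T) u v : all B u -> all (predC B) v -> seq.filter B (u ++ v) = u.
  move=> /all_filterP Bu Bv; rewrite filter_cat Bu.
  by move: Bv; rewrite all_predC has_filter negbK => /eqP ->; rewrite cats0.
move=> As At As' At' E; have := congr1 (seq.filter A) E; rewrite !F // => ss'.
by split=> //; move/eqP: E; rewrite ss' eqseq_cat // eqxx => /eqP.
Qed.

Definition translate (c d : nat) (p : site) : site := (p.1 + c, p.2 + d).

Definition vflip (b : nat) (p : site) : site := (p.1, b - p.2).

Lemma translate_inj c d : injective (translate c d).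
Proof. by move=> [x y] [x' y'] [] /addIn -> /addIn ->. Qed.

Lemma nadj_translate c d : {homo translate c d : u v / nadj u v}.
Proof. by move=> u v; rewrite /nadj /=; lia. Qed.

Lemma saw_translate c d p q s :
  saw p q s -> saw (translate c d p) (translate c d q) (map (translate c d) s).
Proof.
by apply: saw_map => u v _ _; [apply: translate_inj|apply: nadj_translate].
Qed.

Lemma vflipK a b : {in in_box a b, involutive (vflip b)}.
Proof. by move=> [x y] /andP[/= _ yb]; rewrite /vflip /= subKn. Qed.

Lemma saw_vflip a b p q s : all (in_box a b) s ->
  saw p q s -> saw (vflip b p) (vflip b q) (map (vflip b) s).
Proof.
move=> /allP sB; apply: saw_map => u v us vs.
  by apply: (can_in_inj (@vflipK a b)); apply: sB.
by move: (sB u us) (sB v vs); rewrite /in_box /nadj /=; lia.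
Qed.

(* Three boxes side by side with a gap of one column: the middle walk is
   flipped so that it runs from the top left to the bottom right corner. *)
Definition glue3 (a1 a2 b : nat) (w : seq site * seq site * seq site) : seq site :=
  w.1.1 ++ (map (translate a1.+1 0) (map (vflip b) w.1.2) ++ map (translate (a1 + a2).+2 0) w.2).

Lemma W_glue3 a1 a2 a3 b :
  W a1 b * W a2 b * W a3 b <= W (a1 + a2 + a3).+2 b.
Proof.
pose ws := [seq (w, w3) | w <- [seq (w1, w2) | w1 <- walks a1 b, w2 <- walks a2 b],
                          w3 <- walks a3 b].
have -> : W a1 b * W a2 b * W a3 b = size ws by rewrite !size_allpairs.
have wsP w : w \in ws ->
    [/\ w.1.1 \in walks a1 b, w.1.2 \in walks a2 b & w.2 \in walks a3 b].
  by case/allpairsP => -[[w1 w2] w3] [/= /allpairsP[[x y] [/= ? ? [-> ->]]] ? ->].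
apply: (leq_size_inj (f := glue3 a1 a2 b)).
- rewrite !allpairs_uniq ?walks_uniq //; first by move=> [? ?] [? ?] _ _ [-> ->].
  by move=> [[? ?] ?] [[? ?] ?] _ _ [-> -> ->].
- move=> [[w1 w2] w3] [[v1 v2] v3] /wsP[] /=; rewrite !mem_walks.
  move=> /andP[_ /allP w1B] /andP[_ /allP w2B] /andP[_ /allP w3B] /wsP[] /=.
  rewrite !mem_walks.
  move=> /andP[_ /allP v1B] /andP[_ /allP v2B] /andP[_ /allP v3B].
  (* The three pieces occupy disjoint ranges of columns, so bounds on the abscissa separate them
     again. *)
  move=> /(cat_inj_pred (A := fun p => p.1 <= a1))[].
  - by apply/allP => p /w1B/andP[].
  - apply/allP => p; rewrite mem_cat /= => /orP[] /mapP[q _ ->] /=; lia.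
  - by apply/allP => p /v1B/andP[].
  - apply/allP => p; rewrite mem_cat /= => /orP[] /mapP[q _ ->] /=; lia.
  move=> /= ->.
  move=> /(cat_inj_pred (A := fun p => p.1 <= (a1 + a2).+1))[].
  - apply/allP => p /mapP[_ /mapP[q /w2B/andP[qa _] ->] ->] /=; lia.
  - apply/allP => p /mapP[q _ ->] /=; lia.
  - apply/allP => p /mapP[_ /mapP[q /v2B/andP[qa _] ->] ->] /=; lia.
  - apply/allP => p /mapP[q _ ->] /=; lia.
  move=> /(inj_map (@translate_inj _ _)) E2 /(inj_map (@translate_inj _ _)) ->.
  suff -> : w2 = v2 by [].
  have := congr1 (map (vflip b)) E2.
  by rewrite -!map_comp !map_id_in // => p /=; [move/v2B|move/w2B]; apply: vflipK.
move=> [[w1 w2] w3] /wsP[] /=; rewrite !mem_walks /glue3 /=.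
move=> /andP[S1 B1] /andP[S2 B2] /andP[S3 B3].
have S2' := saw_translate a1.+1 0 (saw_vflip B2 S2).
have S3' := saw_translate (a1 + a2).+2 0 S3.
move/allP: B1 => B1; move/allP: B2 => B2; move/allP: B3 => B3.
apply/andP; split; last first.
  apply/allP => z; rewrite !mem_cat => /or3P[/B1| |].
  - rewrite /in_box; lia.
  - move=> /mapP[_ /mapP[q /B2 qB ->] ->]; move: qB; rewrite /in_box /=; lia.
  - move=> /mapP[q /B3 qB ->]; move: qB; rewrite /in_box /=; lia.
have -> : ((a1 + a2 + a3).+2, b) = translate (a1 + a2).+2 0 (a3, b).
  by rewrite /translate /=; congr pair; lia.
apply: saw_cat S1 _ _ _.
- apply: saw_cat S2' S3' _ _.
    by rewrite /nadj /=; lia.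
  move=> z /mapP[_ /mapP[q /B2 qB ->] ->] /mapP[q' /B3 q'B E].
  by have := congr1 fst E; move: qB q'B; rewrite /in_box /=; lia.
- by rewrite /nadj /=; lia.
- move=> z /B1 + ; rewrite mem_cat => + /orP[] /mapP[q _ zE]; rewrite zE /in_box /=; lia.
Qed.

(** Each induction step appends one flipped and one unflipped box, so the number of boxes stays odd
    and the walk ends at the top. A row of k boxes has k(a+1) columns of vertices, hence width
    k(a+1) - 1. *)
Lemma W_glue a b j : W a b ^ (j.*2.+1) <= W (j.*2.+1 * a.+1).-1 b.
Proof.
elim: j => [|j IHj]; first by rewrite expn1 mul1n.
rewrite (_ : (_ * a.+1).-1 = ((j.*2.+1 * a.+1).-1 + a + a).+2); last by nia.
apply: leq_trans (W_glue3 _ _ _ _); rewrite doubleS expnSr leq_mul2r.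
by rewrite [W a b ^ _]expnSr leq_mul2r IHj !orbT.
Qed.

Lemma C_glue L j M : j.*2.+1 * L.+1 <= M.+1 -> C L ^ (j.*2.+1 ^ 2) <= C M.
Proof.
set k := j.*2.+1 => kM.
have kM' : (k * L.+1).-1 <= M by lia.
apply: leq_trans (C_mono kM'); rewrite !C_W -mulnn expnM.
(* First k squares are glued into a strip; then, after transposition, k strips into a square. *)
apply: (@leq_trans (W (k * L.+1).-1 L ^ k)); first by rewrite leq_exp2r // W_glue.
by rewrite [W _ L]W_transpose W_glue.
Qed.

(** * A crude upper bound on the number of walks *)

Definition nbrs (p : site) : seq site :=
  [:: (p.1.+1, p.2); (p.1.-1, p.2); (p.1, p.2.+1); (p.1, p.2.-1)].

(** At a zero coordinate the truncated predecessor lists [p] itself, which is harmless for an upper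
    bound. *)
Lemma mem_nbrs p q : nadj p q -> q \in nbrs p.
Proof.
case: p q => x y [x' y']; rewrite /nadj /= => H.
by rewrite !inE !xpair_eqE /=; lia.
Qed.

Fixpoint npaths (n : nat) (p : site) : seq (seq site) :=
  if n is n'.+1 then [::] :: flatten [seq map (cons q) (npaths n' q) | q <- nbrs p]
  else [:: [::]].

Lemma mem_npaths n p s : path nadj p s -> size s <= n -> s \in npaths n p.
Proof.
elim: n p s => [|n IHn] p [|q s] // /andP[pq qs] sn.
rewrite in_cons -[X in _ || X]/(_ \in flatten [seq map (cons r) (npaths n r) | r <- nbrs p]).
apply/orP; right; apply/flattenP; exists (map (cons q) (npaths n q)).
  by apply: (map_f (fun q => map (cons q) (npaths n q))); apply: mem_nbrs.
by rewrite map_f // IHn.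
Qed.

(** A walk stops or continues in one of four ways, and 1 + 4 * 5^n <= 5^(n+1). *)
Lemma size_npaths n p : size (npaths n p) <= 5 ^ n.
Proof.
elim: n p => [|n IHn] p //=; rewrite !size_cat !size_map /=.
have := expn_gt0 5 n; rewrite expnS.
have := IHn (p.1.+1, p.2); have := IHn (p.1.-1, p.2).
have := IHn (p.1, p.2.+1); have := IHn (p.1, p.2.-1); lia.
Qed.

Lemma C_ub L : C L <= 5 ^ (L.+1 ^ 2).
Proof.
rewrite C_W /W; apply: leq_trans (size_npaths (L.+1 ^ 2) (0, 0)).
apply: (leq_size_inj (f := behead)); first exact: walks_uniq.
  by move=> s t /walks_cons {2}-> /walks_cons {2}-> ->.
move=> s sW; have sE := walks_cons sW; move: sW => /mapP[w].
rewrite mem_enum inE => + E; rewrite -E sE => /and4P[_ _ P _].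
apply: mem_npaths P _; rewrite -ltnS -[_.+1]/(size ((0, 0) :: behead s)) -sE ltnW // ltnS.
by rewrite E size_map (leq_trans (size_bseq w)) // card_prod !card_ord expnS expn1.
Qed.

(** * Walks and polygons *)

Lemma adjC L : symmetric (@adj L).
Proof. by move=> u v; rewrite /adj distnC [X in _ + X]distnC. Qed.

Lemma cycle_edges_rot L i (c : seq (vertex L)) :
  uniq c -> cycle_edges (rot i c) = cycle_edges c.
Proof.
move=> Uc; apply/setP => e; apply/imsetP/imsetP => -[v vc ->]; exists v.
- by rewrite mem_rot in vc.
- by rewrite next_rot.
- by rewrite mem_rot.
- by rewrite next_rot.
Qed.

Lemma set2C (T : finType) (x y : T) : [set x; y]%SET = [set y; x]%SET.
Proof. exact: finset.setUC. Qed.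

Lemma cycle_edges_rev L (c : seq (vertex L)) :
  uniq c -> cycle_edges (rev c) = cycle_edges c.
Proof.
move=> Uc; apply/setP => e; apply/imsetP/imsetP => -[v vc ->].
  exists (prev c v); first by rewrite mem_prev -mem_rev.
  by rewrite (next_rev Uc) (next_prev Uc); exact: set2C.
exists (next c v); first by rewrite mem_rev mem_next.
by rewrite (next_rev Uc) (prev_next Uc); exact: set2C.
Qed.

Lemma cycle_edge_neighbor L (c : seq (vertex L)) u v : uniq c ->
  [set u; v]%SET \in cycle_edges c -> u != v -> v = next c u \/ v = prev c u.
Proof.
move=> Uc /imsetP[w wc E] uv.
have : u \in [set w; next c w]%SET by rewrite -E !inE eqxx.
have : v \in [set w; next c w]%SET by rewrite -E !inE eqxx orbT.
rewrite !inE => /orP[] /eqP vE /orP[] /eqP uE.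
- by rewrite uE vE eqxx in uv.
- by right; rewrite uE vE prev_next.
- by left; rewrite uE vE.
- by rewrite uE vE eqxx in uv.
Qed.

Lemma cycle_edges_next L (c : seq (vertex L)) v :
  v \in c -> [set v; next c v]%SET \in cycle_edges c.
Proof. by move=> vc; apply/imsetP; exists v. Qed.

Lemma cycle_edges_mem L (c : seq (vertex L)) e v :
  e \in cycle_edges c -> v \in e -> v \in c.
Proof. by move=> /imsetP[u uc ->]; rewrite !inE => /orP[] /eqP->; rewrite ?mem_next. Qed.

Lemma next_consE (T : eqType) (x y : T) s : next (x :: y :: s) x = y.
Proof. by rewrite /= eqxx. Qed.

Lemma next_neq (T : eqType) (c : seq T) x :
  uniq c -> 1 < size c -> x \in c -> next c x != x.
Proof.
move=> Uc sc xc; have [i s E] := rot_to xc.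
rewrite -!(next_rot i Uc) E; move: Uc sc; rewrite -(rot_uniq i) -(size_rot i) E.
case: s E => [|y s] // _ /andP[+ _] _; rewrite next_consE inE negb_or.
by rewrite eq_sym => /andP[].
Qed.

(** In a cycle of length at least 3 the two neighbours of a vertex differ; this excludes turning
    back in [cycle_edges_inj]. *)
Lemma next_next_neq (T : eqType) (c : seq T) x :
  uniq c -> 2 < size c -> x \in c -> next c (next c x) != x.
Proof.
move=> Uc sc xc; have [i s E] := rot_to xc.
rewrite -!(next_rot i Uc) E; move: Uc sc; rewrite -(rot_uniq i) -(size_rot i) E.
case: s E => [|y [|z s]] // _ /andP[+ /andP[+ _]] _; rewrite next_consE /= !inE !negb_or.
by move=> /and3P[xy xz _] _; rewrite [y == x]eq_sym (negPf xy) eqxx eq_sym.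
Qed.

(** A duplicate-free cycle is the orbit of its head under [next], so comparing cycles reduces to
    comparing iterates of [next]. *)
Lemma traject_next (T : eqType) (x : T) s :
  uniq (x :: s) -> x :: s = traject (next (x :: s)) x (size (x :: s)).
Proof.
move=> /cycle_next; move: (next _) => f; rewrite [fcycle _ _]/= => /fpathE.
rewrite size_rcons => E /=; congr cons.
by have := congr1 (take (size s)) E; rewrite -cats1 take_size_cat // take_traject.
Qed.

(* Each vertex of a polygon has exactly two neighbours in it, so the polygon and
   the first step determine the whole cyclic sequence. *)
Lemma cycle_edges_inj L (x y : vertex L) s t :
  let c := x :: y :: s in let d := x :: y :: t in
  uniq c -> uniq d -> 2 < size c -> 2 < size d ->
  cycle_edges c = cycle_edges d -> s = t.
Proof.
move=> c d Uc Ud sc sd E.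
have sub (c1 c2 : seq (vertex L)) : uniq c1 ->
    cycle_edges c1 = cycle_edges c2 -> size c1 <= size c2.
  move=> U1 E12; apply: uniq_leq_size => // v vc.
  apply: (cycle_edges_mem (e := [set v; next c1 v]%SET)); last by rewrite !inE eqxx.
  by rewrite -E12 cycle_edges_next.
have ss : size c = size d by apply/eqP; rewrite eqn_leq !sub.
have step v : v \in c -> v \in d -> next c v = next d v ->
    next c (next c v) = next d (next c v).
  move=> vc vd vcd; set w := next c v.
  have wc : w \in c by rewrite mem_next.
  have wd : w \in d by rewrite /w vcd mem_next.
  have nw : w != next d w.
    by rewrite eq_sym next_neq // (leq_trans _ sd).
  (* The edge of [d] leaving [w] is an edge of [c] at [w], so it leads to [next c w] or back to [v];
     the latter would bring [d] back to [v] after two steps. *)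
  have := cycle_edges_next wd; rewrite -E => /(cycle_edge_neighbor Uc) /(_ nw)[->//|].
  rewrite /w prev_next // => H.
  by have := next_next_neq Ud sd vd; rewrite -vcd H eqxx.
have iters k : [/\ iter k (next c) x = iter k (next d) x,
    iter k.+1 (next c) x = iter k.+1 (next d) x, iter k (next c) x \in c
    & iter k (next c) x \in d].
  elim: k => [|k [IH1 IH2 IH3 IH4]]; first by rewrite /= !eqxx !mem_head.
  split=> //.
  - have H : next c (iter k (next c) x) = next d (iter k (next c) x).
      by move: IH2; rewrite !iterS -IH1.
    by rewrite !iterS -IH1 -H (step _ IH3 IH4 H).
  - by rewrite iterS mem_next.
  - by rewrite IH2 iterS mem_next -IH1.
suff : c = d by case.
apply: etrans (traject_next Uc) _; apply: etrans (esym (traject_next Ud)).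
rewrite -/c -/d ss; apply: (@eq_from_nth _ x); rewrite !size_traject // => i ic.
by rewrite !nth_traject //; case: (iters i).
Qed.

Lemma consecutive_edge L (s1 s2 : seq (vertex L)) u v :
  uniq (s1 ++ u :: v :: s2) -> [set u; v]%SET \in cycle_edges (s1 ++ u :: v :: s2).
Proof.
move=> U; rewrite -(cycle_edges_rot (size s1) U) rot_size_cat /=.
have uc : u \in u :: v :: (s2 ++ s1) by rewrite inE eqxx.
by have := cycle_edges_next uc; rewrite next_consE.
Qed.

(** * Closing a crossing walk into a polygon *)

Lemma adj_pcoord L (u v : vertex L) : adj u v = nadj (pcoord u) (pcoord v).
Proof. by []. Qed.

Lemma side_hit L (Q : pred (vertex L)) s1 s2 u v :
  uniq (s1 ++ u :: v :: s2) -> adj u v -> Q u -> Q v ->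
  cycle_edges (s1 ++ u :: v :: s2) :&: [set e in edges L | [forall w in e, Q w]]%SET
    != finset.set0.
Proof.
move=> U uv Qu Qv; apply/set0Pn; exists [set u; v]%SET.
rewrite finset.in_setI consecutive_edge // andTb inE; apply/andP; split.
  by apply: (imset_f (fun p => [set p.1; p.2]%SET) (x := (u, v))); rewrite inE.
by apply/forall_inP => w; rewrite !inE => /orP[] /eqP->.
Qed.

Lemma map_unpcoordK n c :
  all (in_box n n) c -> map (@pcoord n n) (map (unpcoord n n) c) = c.
Proof. by move=> /allP cB; rewrite -map_comp map_id_in // => p /cB /unpcoordK. Qed.

Lemma uniq_unpcoord n c : all (in_box n n) c -> uniq c -> uniq (map (unpcoord n n) c).
Proof. by move=> cB Uc; apply: (@map_uniq _ _ (@pcoord n n)); rewrite map_unpcoordK. Qed.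

Lemma saw_side_hit n (Q : pred site) p q c s1 s2 u v :
  saw p q c -> all (in_box n n) c -> c = s1 ++ u :: v :: s2 -> Q u -> Q v ->
  cycle_edges (map (unpcoord n n) c) :&:
    [set e in edges n | [forall w in e, Q (pcoord w)]]%SET != finset.set0.
Proof.
move=> /and4P[_ _ Ps Us] cB E Qu Qv; have U := uniq_unpcoord cB Us.
have uv : nadj u v.
  by have := Ps; rewrite E => /cat_sorted2[_ /= /andP[]].
have [uB vB] : in_box n n u /\ in_box n n v.
  by move: cB; rewrite E all_cat /= => /and4P[].
rewrite E map_cat /= in U *; apply: side_hit => //.
- by rewrite adj_pcoord !unpcoordK.
- by rewrite unpcoordK.
- by rewrite unpcoordK.
Qed.

Lemma closed_saw_ucycle n p q c : saw p q c -> nadj q p -> all (in_box n n) c ->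
  ucycle (@adj n) (map (unpcoord n n) c).
Proof.
move=> /and4P[/eqP + /eqP + Ps Us] qp /allP cB; case: c Ps Us cB => //= x c Ps Us cB.
move=> [xp] cq; apply/andP; split.
  rewrite -map_cons; apply: (@homo_cycle_in _ _ (in_box n n) _ nadj) => [u v uB vB uv||].
  - by rewrite adj_pcoord !unpcoordK.
  - exact/allP.
  - by rewrite /= rcons_path Ps cq xp.
by rewrite -map_cons uniq_unpcoord //; apply/allP.
Qed.

Lemma ucycle_polygon n (c : seq (vertex n)) :
  2 < size c -> ucycle (@adj n) c -> cycle_edges c \in polygons n.
Proof.
move=> sc cc; have /andP[_ Uc] := cc.
have sz : size c <= #|vertex n| by rewrite -(card_uniqP Uc) max_card.
by apply/imsetP; exists (Bseq sz); rewrite ?inE ?sc.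
Qed.

(* Shift the walk by (1,1) and join its ends around the top left of a larger square. *)
Definition loop (L : nat) (w : seq site) : seq site :=
  [:: (L.+2, L.+1), (L.+2, L.+2), (L.+1, L.+2) & hseg L.+2 L 0 ++
    (vseg 0 L.+1 2 ++ [:: (0, 1), (0, 0), (1, 0) & map (translate 1 1) w])].

Lemma saw_cons p p' q s : saw p' q s -> nadj p p' -> p \notin s -> saw p q (p :: s).
Proof.
move=> S pp' ps; rewrite -cat1s; apply: saw_cat (saw1 p) S pp' _ => z.
by rewrite inE => /eqP-> /(negP ps).
Qed.

Lemma loop_in_box L w : all (in_box L L) w -> all (in_box L.+2 L.+2) (loop L w).
Proof.
move=> /allP wB; apply/allP => z; rewrite /loop !(inE, mem_cat) mem_hseg mem_vseg.
move=> /or4P[/eqP->|/eqP->|/eqP->|]; rewrite /in_box /=; try lia.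
move=> /orP[|/orP[|/or4P[/eqP->|/eqP->|/eqP->|/mapP[q /wB qB ->]]]] /=; try lia.
by move: qB; rewrite /in_box /=; lia.
Qed.

(** The pieces are attached from the end of the loop backwards; [m1], [m2], [m3] record the region
    already occupied, which each new piece avoids. The hypothesis 0 < L keeps [vseg 0 L.+1 2] from
    running upwards. *)
Lemma saw_loop L w : 0 < L -> saw (0, 0) (L, L) w -> all (in_box L L) w ->
  saw (L.+2, L.+1) (L.+1, L.+1) (loop L w).
Proof.
move=> L0 /(saw_translate 1 1); rewrite /translate /= !addn1 => S /allP wB.
have mw (z : site) : z \in map (translate 1 1) w -> 0 < z.1 <= L.+1 /\ 0 < z.2 <= L.+1.
  by move=> /mapP[q /wB qB ->]; move: qB; rewrite /in_box /=; lia.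
have notin (z : site) s : (z \in s -> False) -> z \notin s by move=> H; apply/negP.
rewrite /loop.
have S1 : saw (0, 1) (L.+1, L.+1) [:: (0, 1), (0, 0), (1, 0) & map (translate 1 1) w].
  apply: (saw_cons (p' := (0, 0))); last 2 first => //.
    apply: notin; rewrite !inE !xpair_eqE /=; move=> /mw /=; lia.
  apply: (saw_cons (p' := (1, 0))); last 2 first => //.
    apply: notin; rewrite !inE !xpair_eqE /=; move=> /mw /=; lia.
  apply: (saw_cons S) => //; apply: notin; move=> /mw /=; lia.
have m1 (z : site) : z \in [:: (0, 1), (0, 0), (1, 0) & map (translate 1 1) w] ->
    z.1 = 0 /\ z.2 <= 1 \/ 0 < z.1 <= L.+1 /\ z.2 <= L.+1.
  by rewrite !inE => /or4P[/eqP->|/eqP->|/eqP->|/mw] /=; lia.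
have S2 : saw (0, L.+1) (L.+1, L.+1)
    (vseg 0 L.+1 2 ++ [:: (0, 1), (0, 0), (1, 0) & map (translate 1 1) w]).
  apply: (saw_cat (saw_vseg 0 L.+1 2) S1) => // z.
  by rewrite mem_vseg => z0 /m1; lia.
have m2 (z : site) : z \in vseg 0 L.+1 2 ++ [:: (0, 1), (0, 0), (1, 0) & map (translate 1 1) w] ->
    z.1 <= L.+1 /\ z.2 <= L.+1.
  by rewrite mem_cat mem_vseg => /orP[|/m1]; lia.
have S3 : saw (L, L.+2) (L.+1, L.+1) (hseg L.+2 L 0 ++
    (vseg 0 L.+1 2 ++ [:: (0, 1), (0, 0), (1, 0) & map (translate 1 1) w])).
  apply: (saw_cat (saw_hseg L.+2 L 0) S2); first by rewrite /nadj /=; lia.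
  by move=> z; rewrite mem_hseg => z0 /m2; lia.
have m3 (z : site) : z \in hseg L.+2 L 0 ++
    (vseg 0 L.+1 2 ++ [:: (0, 1), (0, 0), (1, 0) & map (translate 1 1) w]) ->
    z.1 <= L /\ z.2 = L.+2 \/ z.1 <= L.+1 /\ z.2 <= L.+1.
  by rewrite mem_cat mem_hseg => /orP[|/m2]; lia.
apply: (@saw_cons _ (L.+2, L.+2)); last 2 first.
- by rewrite /nadj /=; lia.
- by apply: notin; rewrite 2!in_cons !xpair_eqE => /or3P[| |/m3 /=]; lia.
apply: (@saw_cons _ (L.+1, L.+2)); last 2 first.
- by rewrite /nadj /=; lia.
- by apply: notin; rewrite in_cons !xpair_eqE => /orP[|/m3 /=]; lia.
apply: (@saw_cons _ (L, L.+2) _ _ S3); first by rewrite /nadj /=; lia.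
by apply: notin => /m3 /=; lia.
Qed.

Lemma loop_inj L : injective (loop L).
Proof.
move=> w w' [] /eqP; rewrite !eqseq_cat // !eqxx /= => /eqP[].
exact/inj_map/translate_inj.
Qed.

Lemma C_leq_P4 L : 0 < L -> C L <= P4 L.+2.
Proof.
move=> L0; rewrite C_W /W /P4 cardE.
set n := L.+2; pose f w := cycle_edges (map (unpcoord n n) (loop L w)).
have wP w : w \in walks L L ->
    [/\ saw (n, L.+1) (L.+1, L.+1) (loop L w), all (in_box n n) (loop L w)
      & ucycle (@adj n) (map (unpcoord n n) (loop L w))].
  rewrite mem_walks => /andP[wS wB].
  have S := saw_loop L0 wS wB; have B := loop_in_box wB; split=> //.
  by apply: closed_saw_ucycle S _ B; rewrite /nadj /=; lia.
apply: (leq_size_inj (f := f)) => [|w v /wP[_ wB /andP[_ wU]] /wP[_ vB /andP[_ vU]] wv|w].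
- exact: walks_uniq.
(* Every loop starts with (n, L+1), (n, n), which is the common first step that [cycle_edges_inj]
   asks for. *)
- have := cycle_edges_inj wU vU isT isT wv.
  move=> E; apply: (@loop_inj L); rewrite -(map_unpcoordK wB) -(map_unpcoordK vB).
  congr map; exact: (congr1 (fun s => _ :: _ :: s) E).
move=> /wP[S wB uc]; rewrite mem_enum inE ucycle_polygon // andTb.
apply/and4P; split.
(* The loop passes through the corners (0, 0) and (n, n), and its edges there lie on the four
   sides. *)
- apply: (saw_side_hit (Q := fun p => p.2 == 0) (u := (0, 0)) (v := (1, 0))
    (s1 := [:: (n, L.+1), (n, n), (L.+1, n) & hseg n L 0 ++ (vseg 0 L.+1 2 ++ [:: (0, 1)])]) S) => //.
  by rewrite /loop /= -!catA.
- exact: (saw_side_hit (Q := fun p => p.2 == n) (s1 := [:: (n, L.+1)]) S wB erefl).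
- apply: (saw_side_hit (Q := fun p => p.1 == 0) (u := (0, 1)) (v := (0, 0))
    (s1 := [:: (n, L.+1), (n, n), (L.+1, n) & hseg n L 0 ++ vseg 0 L.+1 2]) S) => //.
  by rewrite /loop /= -!catA.
- exact: (saw_side_hit (Q := fun p => p.1 == n) (s1 := [::]) S wB erefl).
Qed.

(** * Opening a polygon into a crossing walk *)

(** The cycle is oriented so that it closes up along the edge from the right neighbour of [v] back
    to [v]; without this edge, [v :: c] is a walk between the two. *)
Definition rooted_lowest L (E : {set {set vertex L}}) (r : vertex L * seq (vertex L)) :=
  let v := r.1 in let c := r.2 in
  [/\ cycle_edges (v :: c) = E, uniq (v :: c), path (@adj L) v c,
      pcoord (last v c) = ((pcoord v).1.+1, (pcoord v).2)
    & {in v :: c, forall u, (pcoord v).2 <= (pcoord u).2}].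

(* The two neighbours in the polygon of its lowest leftmost vertex v are the
   ones to the right of v and above v. *)
Lemma polygon_rooted_lowest L E : E \in polygons L -> exists r, rooted_lowest E r.
Proof.
move=> /imsetP[c0]; rewrite inE => /andP[sc0 cc0] ->.
have /hasP[x0 xc0 _] : has predT c0 by rewrite has_predT; lia.
(* As abscissas are at most L, minimizing [f] selects the lowest row first and then its leftmost
   vertex. *)
pose f (u : vertex L) := (pcoord u).2 * L.+1 + (pcoord u).1.
case: (@arg_minnP _ x0 (mem c0) f xc0) => v vc vmin.
have [i [|y s] Es] := rot_to vc; first by move: sc0; rewrite -(size_rot i) Es.
have Uc : uniq c0 by case/andP: cc0.
rewrite -(cycle_edges_rot i Uc) Es.
have {cc0} : ucycle (@adj L) (v :: y :: s) by rewrite -Es rot_ucycle.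
have low u : u \in v :: y :: s -> f v <= f u.
  by rewrite -Es mem_rot => /vmin.
have {sc0} : 2 < size (v :: y :: s) by rewrite -Es size_rot.
clear Es vc vmin => ss /andP[Cs Us].
have lowy : {in v :: y :: s, forall u, (pcoord v).2 <= (pcoord u).2}.
  move=> u /low; rewrite /f; have /andP[] := pcoord_in_box u.
  move: (pcoord u) (pcoord v) => [a b] [a' b'] /= aL _ H; rewrite leqNgt; apply/negP => bb.
  nia.
have pathP t : cycle (@adj L) (v :: t) -> path (@adj L) v t.
  by rewrite /= rcons_path => /andP[].
have vy : adj v y by move: Cs => /= /andP[].
have vz : adj v (last y s) by rewrite adjC; move: Cs; rewrite /= rcons_path => /and3P[].
have yz : y != last y s.
  case: (s) ss Us => // z s' _ /and3P[_ + _]; apply: contra => /eqP /= ->; exact: mem_last.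
have ly : f v <= f y by apply: low; rewrite !inE eqxx orbT.
have lz : f v <= f (last y s) by apply: low; rewrite inE mem_last orbT.
have [Ez|Ey] : pcoord (last y s) = ((pcoord v).1.+1, (pcoord v).2) \/
               pcoord y = ((pcoord v).1.+1, (pcoord v).2).
  have : pcoord y != pcoord (last y s) by rewrite (inj_eq (@pcoord_inj L L)).
  have : (pcoord v).2 <= (pcoord y).2 by apply: lowy; rewrite !inE eqxx orbT.
  have : (pcoord v).2 <= (pcoord (last y s)).2 by apply: lowy; rewrite inE mem_last orbT.
  move: vy vz ly lz; rewrite !adj_pcoord /f /nadj.
  case: (pcoord y) (pcoord v) (pcoord (last y s)) => [a b] [a' b'] [a2 b2] /=.
  rewrite xpair_eqE => vy vz ly lz b2b' bb' ne.
  have {}ly : b = b' -> a' <= a by move=> e; rewrite e leq_add2l in ly.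
  have {}lz : b2 = b' -> a' <= a2 by move=> e; rewrite e leq_add2l in lz.
  have [[-> ->]|[-> ->]] : a2 = a'.+1 /\ b2 = b' \/ a = a'.+1 /\ b = b' by lia.
    by left.
  by right.
- by exists (v, y :: s); split=> //; apply: pathP.
(* Here the right neighbour comes right after [v]: the cycle is reversed, and rotated to start at
   [v] again. *)
have Er : rotr 1 (rev (v :: y :: s)) = v :: rev (y :: s).
  by rewrite rev_cons rotr1_rcons.
exists (v, rev (y :: s)); split.
- by rewrite -[_ :: _]Er /rotr cycle_edges_rot ?rev_uniq // cycle_edges_rev.
- by rewrite -[_ :: _]Er rotr_uniq rev_uniq.
- apply: pathP; rewrite -Er rotr_cycle rev_cycle.
  by rewrite -(eq_cycle (e := @adj L)) // => u w; rewrite adjC.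
- by rewrite /= rev_cons last_rcons.
- by move=> u; rewrite -[_ :: _]Er mem_rotr mem_rev; apply: lowy.
Qed.

(* Joins the ends (x, y) and (x + 1, y) of c, shifted by (1, 1), straight down to the
   bottom side and then to the opposite corners (0, 0) and (L + 2, L + 2). *)
Definition opening (L x y : nat) (c : seq site) : seq site :=
  hseg 0 0 x ++ (vseg x.+1 0 y ++ (map (translate 1 1) c ++
    (vseg x.+2 y 0 ++ (hseg 0 x.+3 L.+2 ++ vseg L.+2 1 L.+2)))).

(** After the shift [c] lies strictly above row y, which leaves room for the two vertical strands.
    The end (x+1, y) of [c] is in the box, so x + 3 <= L + 2 and the last pieces fit. *)
Lemma opening_walks L x y c : saw (x, y) (x.+1, y) c -> all (in_box L L) c ->
  {in c, forall u, y <= u.2} -> opening L x y c \in walks L.+2 L.+2.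
Proof.
move=> cS /allP cB cy.
have /andP[/= xL yL] : in_box L L (x.+1, y).
  apply: cB; move: cS => /and4P[+ /eqP <- _ _]; case: (c) => //= p s _; exact: mem_last.
have S2 := saw_translate 1 1 cS; rewrite /translate /= !addn1 in S2.
have mc (z : site) : z \in map (translate 1 1) c -> 0 < z.1 <= L.+1 /\ y < z.2 <= L.+1.
  move=> /mapP[q qc ->]; move: (cB q qc) (cy q qc); rewrite /in_box /=; lia.
rewrite mem_walks /opening; apply/andP; split; last first.
  apply/allP => z; rewrite !mem_cat !mem_hseg !mem_vseg /in_box.
  move=> /or4P[||/mc|/or3P[]] /=; lia.
apply: (saw_cat (p' := (x.+1, 0)) (saw_hseg 0 0 x)); [|by rewrite /nadj /=; lia|]; last first.
  move=> z; rewrite !mem_cat !mem_hseg !mem_vseg => + /or3P[|/mc|/or3P[]] /=; lia.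
apply: (saw_cat (p' := (x.+1, y.+1)) (saw_vseg x.+1 0 y)); [|by rewrite /nadj /=; lia|]; last first.
  move=> z; rewrite !mem_cat !mem_hseg !mem_vseg => + /orP[/mc|/or3P[]] /=; lia.
apply: (saw_cat (p' := (x.+2, y)) S2); [|by rewrite /nadj /=; lia|]; last first.
  move=> z; rewrite !mem_cat !mem_hseg !mem_vseg => /mc + /or3P[] /=; lia.
apply: (saw_cat (p' := (x.+3, 0)) (saw_vseg x.+2 y 0)); [|by rewrite /nadj /=; lia|]; last first.
  move=> z; rewrite !mem_cat !mem_hseg !mem_vseg => + /orP[] /=; lia.
apply: (saw_cat (p' := (L.+2, 1)) (saw_hseg 0 x.+3 L.+2)); [|by rewrite /nadj /=; lia|]; last first.
  move=> z; rewrite mem_hseg !mem_vseg => + /=; lia.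
exact: saw_vseg.
Qed.

(** For fixed x and y only the middle block varies; equal total lengths give it a fixed size, so the
    blocks can be compared one by one. *)
Lemma opening_inj L x y : injective (opening L x y).
Proof.
move=> c d /eqP; rewrite /opening 2?eqseq_cat // !eqxx !andTb => /eqP E.
have sz : size c = size d.
  by have := congr1 size E; rewrite !size_cat !size_map; lia.
move/eqP: E; rewrite eqseq_cat ?size_map // => /andP[/eqP + _].
exact/inj_map/translate_inj.
Qed.

Lemma P_leq_C L : P L <= L.+1 ^ 2 * C L.+2.
Proof.
rewrite C_W /W /P cardE.
(* One rooting per polygon is chosen; other edge sets get a dummy value. *)
have /boolp.choice[g gP] : forall E, exists r, E \in polygons L -> rooted_lowest E r.
  move=> E.
  have [/polygon_rooted_lowest[r rE]|_] := boolP (E \in polygons L); first by exists r.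
  by exists ((ord0, ord0), [::]).
pose F E := ((g E).1,
  opening L (pcoord (g E).1).1 (pcoord (g E).1).2 (map (@pcoord L L) ((g E).1 :: (g E).2))).
have -> : L.+1 ^ 2 * size (walks L.+2 L.+2) =
    size [seq (v, w) | v <- enum {: vertex L}, w <- walks L.+2 L.+2].
  by rewrite size_allpairs -cardE card_prod !card_ord mulnn.
apply: (leq_size_inj (f := F)) => [|E E'|E]; first exact: enum_uniq.
  rewrite !mem_enum => /gP[cE _ _ _ _] /gP[cE' _ _ _ _] FE.
  have vv : (g E).1 = (g E').1 := congr1 fst FE.
  have := (congr1 snd FE : opening _ _ _ _ = opening _ _ _ _).
  by rewrite vv => /opening_inj/(inj_map (@pcoord_inj L L)) cc; rewrite -cE -cE' vv cc.
rewrite mem_enum => /gP[_ Uc pc lc yc]; apply/allpairsP; eexists (_, _); split=> //=.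
  by rewrite mem_enum.
apply: opening_walks.
- apply/and4P; split; rewrite ?map_inj_uniq //; last exact: pcoord_inj.
  + by rewrite /= last_map lc.
  + by rewrite /= path_map.
- by apply/allP => _ /mapP[u _ ->]; apply: pcoord_in_box.
- by move=> _ /mapP[u /yc + ->].
Qed.

Local Open Scope ring_scope.
Local Open Scope classical_set_scope.

(** * Limits *)

(* L + 1 is the distance between the cells in the tiling behind C_glue, so this
   normalization makes the rate superadditive without an error term. *)
Definition cell_rate (R : realType) (L : nat) : R := ln ((C L)%:R : R) / L.+1%:R ^+ 2.

Lemma lnC_ge0 (R : realType) L : 0 <= ln ((C L)%:R : R).
Proof. by rewrite ln_ge0 // ler1n C_gt0. Qed.

Lemma cell_rateE (R : realType) L : ln ((C L)%:R : R) = cell_rate R L * L.+1%:R ^+ 2.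
Proof. by rewrite /cell_rate divfK // expf_neq0 // pnatr_eq0. Qed.

Lemma cell_rate_ge0 (R : realType) L : 0 <= cell_rate R L.
Proof. by rewrite divr_ge0 ?lnC_ge0 // exprn_ge0. Qed.

Lemma cell_rate_le (R : realType) L : cell_rate R L <= ln 5.
Proof.
rewrite ler_pdivrMr ?exprn_gt0 ?ltr0n //.
have -> : ln 5 * L.+1%:R ^+ 2 = ln ((5 ^ (L.+1 ^ 2))%N%:R : R).
  by rewrite natrX lnXn // -natrX mulr_natr.
by rewrite ler_ln ?posrE ?ltr0n ?C_gt0 ?expn_gt0 // ler_nat C_ub.
Qed.

(** With k the largest odd number of cells fitting along a side, the tiles cover a fraction t =
    k(L+1)/(M+1) >= 1 - d of it, where d = 2(L+1)/(M+1). Then t^2 >= 1 - 2d, and the loss is at most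
    2d ln 5. *)
Lemma cell_rate_glue (R : realType) L M : (L <= M)%N ->
  cell_rate R L - 4 * L.+1%:R * ln 5 / M.+1%:R <= cell_rate R M.
Proof.
move=> LM; set q := (M.+1 %/ L.+1)%N; set j := (q.-1)./2.
have q0 : (0 < q)%N by rewrite divn_gt0.
have := divn_eq M.+1 L.+1; have := ltn_pmod M.+1 (ltn0Sn L); rewrite -/q.
move: (M.+1 %% L.+1)%N => r rL qE.
have [qk kq] : (q <= j.*2.+1.+1 /\ j.*2.+1 <= q)%N by rewrite /j; lia.
have kM : (j.*2.+1 * L.+1 <= M.+1)%N by nia.
(* Parity loses at most one cell and the division less than one. *)
have Mk : (M.+1 <= j.*2.+1 * L.+1 + 2 * L.+1)%N by nia.
move: (j.*2.+1) kM Mk (C_glue kM) => k kM Mk CkM {j q q0 qE qk kq}.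
set d : R := 2 * L.+1%:R / M.+1%:R; set t : R := k%:R * L.+1%:R / M.+1%:R.
have M0 : 0 < M.+1%:R :> R by rewrite ltr0n.
have td : 1 - d <= t.
  rewrite lerBlDr -mulrDl ler_pdivlMr // mul1r -!natrM -natrD ler_nat //.
have ht : t ^+ 2 * cell_rate R L <= cell_rate R M.
  rewrite [cell_rate R M]/cell_rate ler_pdivlMr ?exprn_gt0 //.
  rewrite [X in X <= _](_ : _ = ln ((C L ^ (k ^ 2))%N%:R)); last first.
    rewrite natrX lnXn ?ltr0n ?C_gt0 // cell_rateE -[RHS]mulr_natr natrX /t.
    field.
    by rewrite lt0r_neq0.
  by rewrite ler_ln ?posrE ?ltr0n ?expn_gt0 ?C_gt0 // ler_nat.
have := cell_rate_ge0 R L; have := cell_rate_le R L.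
have d0 : 0 <= d by rewrite divr_ge0 // mulr_ge0.
rewrite (_ : 4 * _ * _ / _ = 2 * d * ln 5); last by rewrite /d; ring.
move: ht; move: (cell_rate R L) (ln 5 : R) (cell_rate R M) => h B h' ht hB h0.
(* Indeed t^2 >= 2t - 1 >= 1 - 2d. *)
have : (1 - 2 * d) * h <= t ^+ 2 * h.
  by rewrite ler_wpM2r //; nra.
nra.
Qed.

(** As in Fekete's lemma: fix L with rate within e/2 of the supremum; for large M the gluing loss is
    below e/2 as well. *)
Lemma cell_rate_cvg (R : realType) :
  cell_rate R @ \oo --> sup (range (cell_rate R)).
Proof.
have ub : has_ubound (range (cell_rate R)).
  by exists (ln 5) => _ [L _ <-]; apply: cell_rate_le.
have hs : has_sup (range (cell_rate R)) by split=> //; exists (cell_rate R 0), 0%N.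
apply/cvgrPdist_le => /= e e0.
have e20 : 0 < e / 2 by rewrite divr_gt0.
have [_ [L _ <-] SL] := sup_adherent e20 hs.
near=> M.
have MS : cell_rate R M <= sup (range (cell_rate R)) by apply: ub_le_sup => //; exists M.
rewrite ger0_norm ?subr_ge0 //.
have LM : (L <= M)%N by near: M; exact: nbhs_infty_ge.
have := cell_rate_glue R LM; set X := 4 * _ * _ / _ => hX.
suff : X <= e / 2.
  move: SL hX {MS}; move: (sup _) (cell_rate R L) (cell_rate R M) X => S h h' X.
  by lra.
rewrite ler_pdivrMr ?ltr0n // -ler_pdivrMl // (@le_trans _ _ M%:R) ?ler_nat //.
by near: M; exact: nbhs_infty_ger.
Unshelve. all: by end_near. Qed.

(** * Changing the normalization *)

Lemma cvg_shift_harmonic (R : realType) k :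
  (fun n => harmonic (n + k)%N : R) @ \oo --> (0 : R).
Proof. by rewrite (cvg_shiftn k); exact: cvg_harmonic. Qed.

Lemma cvg_natr_ratio (R : realType) (a b : nat) :
  (fun n => (n + a).+1%:R / (n + b).+1%:R : R) @ \oo --> (1 : R).
Proof.
rewrite (_ : (fun n => _) = (fun n => 1 + (a%:R - b%:R) * harmonic (n + b)%N)); last first.
  apply/funext => n; rewrite /harmonic /=.
  have : (n + b).+1%:R != 0 :> R by rewrite pnatr_eq0.
  by rewrite -[(n + a).+1]addn1 -[(n + b).+1]addn1 !natrD => ?; field.
rewrite -[X in _ --> X]addr0 -[X in _ --> _ + X](mulr0 (a%:R - b%:R)).
apply: cvgD; first exact: cvg_cst.
by apply: cvgM; [exact: cvg_cst|exact: cvg_shift_harmonic].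
Qed.

Lemma cvg_natr_ratio_sqr (R : realType) (a b : nat) :
  (fun n => ((n + a).+1%:R / (n + b).+1%:R) ^+ 2 : R) @ \oo --> (1 : R).
Proof.
set r : nat -> R := fun n => (n + a).+1%:R / (n + b).+1%:R.
have r1 : r @ \oo --> (1 : R) by exact: cvg_natr_ratio.
rewrite -[X in _ --> X]mulr1 (_ : (fun n => _) = (fun n => r n * r n)).
  exact: (cvgM r1 r1).
by apply/funext => n; rewrite -expr2.
Qed.

(** All four counts are treated at once, as C(L-2) <= N(L) <= (L+1)^2 C(L+2) with L = n + 3. This
    indexing avoids subtraction and keeps L - 2 positive, as [C_leq_P4] requires. *)
Lemma growth_sandwich (R : realType) (N : nat -> nat) :
  (forall n, C n.+1 <= N n.+3)%N -> (forall n, N n.+3 <= n.+4 ^ 2 * C n.+1.+4)%N ->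
  growth R N @ \oo --> sup (range (cell_rate R)).
Proof.
move=> CN NC; set S := sup _; rewrite -(cvg_shiftn 3).
have shift_rate k : (fun n => cell_rate R (n + k)%N) @ \oo --> S.
  by rewrite (cvg_shiftn k); exact: cell_rate_cvg.
(* The factor replaces the denominator (n+k+1)^2 of [cell_rate] by the (n+3)^2 of [growth]; k = 1
   and k = 5 give the lower and upper bounds. *)
have lim k : (fun n => cell_rate R (n + k)%N * ((n + k).+1%:R / (n + 2).+1%:R) ^+ 2) @ \oo --> S.
  rewrite -[X in _ --> X]mulr1.
  by apply: cvgM; [exact: shift_rate|exact: cvg_natr_ratio_sqr].
have err : (fun n => 2 * harmonic (n + 2)%N : R) @ \oo --> (0 : R).
  rewrite -[X in _ --> X](mulr0 2).
  by apply: cvgM; [exact: cvg_cst|exact: cvg_shift_harmonic].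
have up : (fun n => 2 * harmonic (n + 2)%N +
    cell_rate R (n + 5)%N * ((n + 5).+1%:R / (n + 2).+1%:R) ^+ 2) @ \oo --> S.
  by rewrite -[S]add0r; apply: cvgD err (lim 5%N).
apply: squeeze_cvgr (lim 1%N) up; apply: nearW => n /=.
have rescale k m : cell_rate R k * (k.+1%:R / m) ^+ 2 = ln (C k)%:R / m ^+ 2.
  by rewrite expr_div_n mulrA -cell_rateE.
rewrite !addnS !addn0 !rescale /growth.
have N0 : (0 < N n.+3)%N by apply: leq_trans (CN n); exact: C_gt0.
have n3 : 0 < n.+3%:R :> R by rewrite ltr0n.
apply/andP; split.
  by rewrite ler_pM2r ?invr_gt0 ?exprn_gt0 // ler_ln ?posrE ?ltr0n ?C_gt0 // ler_nat.
have lnN : ln (N n.+3)%:R <= ln n.+4%:R *+ 2 + ln (C n.+1.+4)%:R :> R.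
  rewrite -lnXn ?ltr0n // -natrX -lnM ?posrE ?ltr0n ?C_gt0 ?expn_gt0 // -natrM.
  by rewrite ler_ln ?posrE ?ltr0n ?muln_gt0 ?expn_gt0 ?C_gt0 // ler_nat.
(* By ln(1 + x) <= x, the polynomial factor contributes at most 2(n+3)/(n+3)^2 = 2/(n+3). *)
have ln4 : ln n.+4%:R <= n.+3%:R :> R.
  by rewrite -nat1r; apply: le_ln1Dx; rewrite (lt_trans _ n3) // ltrN10.
have -> : 2 / n.+3%:R = n.+3%:R *+ 2 / n.+3%:R ^+ 2 :> R.
  rewrite -mulr_natl; field; exact: lt0r_neq0.
rewrite -mulrDl ler_pM2r ?invr_gt0 ?exprn_gt0 //.
by apply: (le_trans lnN); rewrite lerD2r lerMn2r ln4.
Qed.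


Unset Implicit Arguments.

Theorem mainTheorem1 (R : realType) :
  [/\ growth R C @ \oo --> ln (lambda R),
      growth R P4 @ \oo --> ln (lambda R),
      growth R P2 @ \oo --> ln (lambda R) &
      growth R P @ \oo --> ln (lambda R)].
Proof.
have C13 n : (C n.+1 <= C n.+3)%N by apply: C_mono; rewrite !ltnS leqW.
have P42 n : (P4 n <= P2 n)%N.
  apply: subset_leq_card; apply/fintype.subsetP => E; rewrite !inE.
  by move=> /and5P[-> -> ->].
have P2P n : (P2 n <= P n)%N.
  by apply: subset_leq_card; apply/fintype.subsetP => E; rewrite !inE => /andP[].
have CP4 n : (C n.+1 <= P4 n.+3)%N by apply: C_leq_P4.
have PC n : (P n.+3 <= n.+4 ^ 2 * C n.+1.+4)%N by exact: P_leq_C.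
(* By monotonicity [C] itself fits the sandwich. This shows that the limit in [lambda] is a genuine
   one and identifies ln [lambda] with the supremum. *)
have CS : growth R C @ \oo --> sup (range (cell_rate R)).
  apply: growth_sandwich => // n; apply: leq_trans (leq_pmull _ _).
    by apply: C_mono; rewrite !ltnS; lia.
  by rewrite expn_gt0.
rewrite /lambda expRK (cvg_lim _ CS) //; split=> //; apply: growth_sandwich => // n.
- exact: leq_trans (P42 _) (leq_trans (P2P _) (PC _)).
- exact: leq_trans (CP4 _) (P42 _).
- exact: leq_trans (P2P _) (PC _).
- exact: leq_trans (CP4 _) (leq_trans (P42 _) (P2P _)).
Qed.
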